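(* For any user $i$, with parameters $d_i>0$, $p_i\in(0,1]$ and $\rho_i\in(0,1]$, the Whittle's index of the one-dimensional problem described in the context is as follows, for every $n\in\mathbb{N}$. (AoI metric) The Whittle's index of the state $c_i^n$ is $$W_i(c_i^{n})=\frac{n(n+1)\rho_i}{2}+n+1.$$ (AoII metric) The Whittle's index of the state $b_i^n$ is $$W_i(b_i^{n})=d_ip_i\left[\frac{1}{3}\rho_i n^3+\Big(1+\frac{\rho_i}{2}\Big)n^2+\Big(1+\frac{\rho_i}{6}+\frac{1}{\rho_i}\Big)n+\frac{1}{\rho_i}\right]=d_ip_i\,w_i(n),$$ where $w_i(n)$ denotes the expression in brackets.
   Context: $\mathbb{N}=\{0,1,2,\dots\}$. User $i$ is a sensor observing a Markov source which at each time slot moves to its next state with probability $p_i$ and stays put with probability $1-p_i$; consecutive source states are at distance $d_i$. A scheduled transmission of user $i$ succeeds with probability $\rho_i$. The age of information (AoI) at time $t$ is $t-g_i(t)$, where $g_i(t)$ is the time-stamp of the last packet successfully received by the monitor; the (expected, distance-based) age of incorrect information (AoII) at time $t$ is $d_ip_i\frac{j(j+1)}{2}$ with $j=t-g_i(t)$. The one-dimensional problem of user $i$ with parameter $W\ge 0$ is the average-cost problem $$\min_{\phi\in\Phi}\ \limsup_{T\to+\infty}\frac1T\,\mathbb{E}^{\phi}\Big(\sum_{t=0}^{T-1}\big(s^{\phi}(t)+W a^{\phi}(t)\big)\,\Big|\,s(0)\Big),$$ where $\Phi$ is the set of all causal policies, for the following Markov decision process with state $s(t)$ and action $a(t)\in\{0,1\}$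 ($1$ = active, i.e. scheduled; $0$ = passive). The states are $x^j$, $j\in\mathbb{N}$, where $x^j=c_i^j:=j$ for the AoI metric and $x^j=b_i^j:=d_ip_i\frac{j(j+1)}{2}$ for the AoII metric. From $x^j$, under action $0$ the next state is $x^{j+1}$ with probability $1$; under action $1$ the next state is $x^0$ with probability $\rho_i$ and $x^{j+1}$ with probability $1-\rho_i$. For $n\in\mathbb{N}$, the threshold policy $n$ takes action $0$ in states $x^j$ with $j<n$ and action $1$ in states $x^j$ with $j\ge n$. For each $W\ge0$ the problem admits an optimal policy of threshold type. $D(W)$ denotes the set of states in which the passive action is optimal with respect to the optimal (threshold) solution: $x^j\in D(W)$ if and only if there is a threshold policy $n$, optimal for the problem with parameter $W$ for every initial state, which prescribes the passive action in $x^j$ (i.e. $j<n$). The problem is indexable, meaning $D(W_1)\subseteq D(W_2)$ whenever $W_1\le W_2$. The Whittle's index of the state $x^n$ is $W_i(x^n)=\min\{W\ge 0 : x^n\in D(W)\}$. *)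

(* Defs.v *)
From mathcomp Require Import all_boot all_order all_algebra.
From mathcomp Require Import all_classical all_reals all_analysis.
Set Implicit Arguments.
Unset Strict Implicit.
Unset Printing Implicit Defensive.
Import Order.TTheory GRing.Theory Num.Theory.
Local Open Scope classical_set_scope.
Local Open Scope ring_scope.

(* The state x^j is represented by its rank j : nat; a metric x : nat -> R
   gives its value.  The action is a boolean, true = active. *)

Definition aoi (R : realType) (j : nat) : R := j%:R.

Definition aoii (R : realType) (d p : R) (j : nat) : R :=
  d * p * (j%:R * (j%:R + 1) / 2).

(* Probability of moving from x^j to x^k under the action a. *)
Definition trans (R : realType) (rho : R) (j : nat) (a : bool) (k : nat) : R :=
  if a then rho * (k == 0%N)%:R + (1 - rho) * (k == j.+1)%:R
  else (k == j.+1)%:R.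

Lemma trans_sum1 (R : realType) (rho : R) (j : nat) (a : bool) :
  \sum_(k < j.+2) trans rho j a k = 1.
Proof.
rewrite big_ord_recl big_ord_recr /= big1 => [|i _]; last first.
  have -> : trans rho j a (bump 0 i) = 0 :> R => //.
  by rewrite /trans /= /bump add1n eqSS (ltn_eqF (ltn_ord i)) !mulr0 addr0 if_same.
by rewrite /trans /= /bump add1n !eqxx; case: a; rewrite /= ?mulr0 ?mulr1
  ?addr0 ?add0r // addrC subrK.
Qed.

(* The sequence of the past (state, action) pairs, oldest first. *)
Definition history := seq (nat * bool).

(* Causal policies may depend on the whole past and may randomize:
   active_prob h j is the probability of the active action in the current
   state x^j after the past h. *)
Record policy (R : realType) := Policy {
  active_prob : history -> nat -> R;
  active_prob_itv : forall h j, 0 <= active_prob h j <= 1 }.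

Definition action_prob (R : realType) (phi : policy R) (h : history) (j : nat)
    (a : bool) : R :=
  if a then active_prob phi h j else 1 - active_prob phi h j.

(* Integral of f over the law of (s(0), a(0)), ..., (s(t+T-1), a(t+T-1)) given
   the past h up to time t = size h and the current state s(t) = x^j: it is the
   iterated integral against the policy and the transition kernel, both of
   finite support (from x^j only x^0 and x^(j+1) can be reached). *)
Fixpoint expectation_from (R : realType) (rho : R) (phi : policy R) (T : nat)
    (h : history) (j : nat) (f : history -> R) : R :=
  if T is T'.+1 then
    \sum_(a : bool) action_prob phi h j a *
      \sum_(k < j.+2) trans rho j a k *
        expectation_from rho phi T' (rcons h (j, a)) k f
  else f h.

Definition total_cost (R : realType) (x : nat -> R) (W : R) (h : history) : R :=
  \sum_(e <- h) (x e.1 + W * e.2%:R).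

(* Long-run average expected cost from s(0) = x^j; it can be +oo. *)
Definition average_cost (R : realType) (rho : R) (x : nat -> R) (W : R)
    (phi : policy R) (j : nat) : \bar R :=
  limn_esup (fun T : nat =>
    (T%:R^-1 * expectation_from rho phi T [::] j (total_cost x W))%:E).

Definition optimal (R : realType) (rho : R) (x : nat -> R) (W : R)
    (phi : policy R) : Prop :=
  forall (j : nat) (psi : policy R),
    (average_cost rho x W phi j <= average_cost rho x W psi j)%E.

Lemma threshold_itv (R : realType) (n : nat) (h : history) (j : nat) :
  0 <= ((n <= j)%N%:R : R) <= 1.
Proof. by rewrite ler0n lern1 leq_b1. Qed.

Definition threshold (R : realType) (n : nat) : policy R :=
  @Policy R (fun _ j => (n <= j)%N%:R) (@threshold_itv R n).

(* D(W), as a set of ranks. *)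
Definition passive_set (R : realType) (rho : R) (x : nat -> R) (W : R) :
    set nat :=
  [set j | exists n : nat, optimal rho x W (threshold R n) /\ (j < n)%N].

(* w = min {W >= 0 | x^n \in D(W)}; in particular the minimum is attained. *)
Definition is_whittle_index (R : realType) (rho : R) (x : nat -> R) (n : nat)
    (w : R) : Prop :=
  let S := [set W : R | 0 <= W /\ passive_set rho x W n] in
  S w /\ lbound S w.

(* Main.v *)
Require Import Defs.
From mathcomp Require Import all_boot all_order all_algebra.
From mathcomp Require Import all_classical all_reals all_analysis.
From mathcomp Require Import ring lra.
Import Order.TTheory GRing.Theory Num.Theory.
Local Open Scope ring_scope.

(* Under the threshold policy n, the process renews each time it reaches x^0,
   so its average cost is
     gain n W = (sum_(j < n) x^j + F n + W / rho) / (n + 1 / rho),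
   where F n = sum_k (1 - rho)^k x^(n + k) is the mean state cost from x^n until
   the next success.  The thresholds n and n + 1 have the same average cost for
   exactly one W, the index of x^n: for that W, the bias (relative value
   function) of the threshold n + 1 solves the average-cost optimality equation,
   and for a smaller W each threshold m > n is strictly worse than m - 1. *)

(** * Limits superior of time averages *)

Lemma average_le (R : realType) (c : nat -> R) (g C : R) :
    (forall T, c T <= g * T%:R + C) ->
  (limn_esup (fun T => (T%:R^-1 * c T)%:E) <= g%:E)%E.
Proof.
move=> cT; apply/lee_addgt0Pr => e e0.
(* Past [N], the constant [C] contributes at most [e] to the average. *)
have [N CN] : exists N : nat, `|C| / e < N%:R.
  by exists (Num.bound (`|C| / e)); apply: archi_boundP; rewrite divr_ge0 // ltW.
apply: le_trans (ereal_inf_lbound _) _.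
  by exists [set T | (N < T)%N]%classic; [exists N.+1 | reflexivity].
apply: ge_ereal_sup => _ [T /= NT <-]; rewrite -EFinD lee_fin.
have T0 : 0 < T%:R :> R by rewrite ltr0n (leq_ltn_trans _ NT).
rewrite ler_pdivrMl //; apply: (le_trans (cT T)).
have : C <= e * T%:R.
  apply: (le_trans (ler_norm C)); rewrite -ler_pdivrMl // mulrC ltW //.
  by apply: (lt_trans CN); rewrite ltr_nat.
lra.
Qed.

(* Where [c T] stays below [g' * T] with [g' < g], the hypothesis forces
   increments growing linearly in [T], hence a quadratic lower bound. *)
Lemma average_ge (R : realType) (c : nat -> R) (g B C : R) : 0 < B ->
    (forall T, g * T%:R <= (1 - B) * c T + B * c T.+1 + C) ->
  (g%:E <= limn_esup (fun T => (T%:R^-1 * c T)%:E))%E.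
Proof.
move=> B0 cT; rewrite leNgt; apply/negP.
move=> /ereal_inf_lt [_ [V [N _ NV] <-] Vg].
have [g' g'g cg'] : exists2 g' : R, g' < g &
    forall T, (N < T)%N -> c T <= g' * T%:R.
  have VT T : (N < T)%N -> ((T%:R^-1 * c T)%:E <=
      ereal_sup [set (T%:R^-1 * c T)%:E | T in V])%E.
    by move=> NT; apply: ereal_sup_ubound; exists T => //; apply: NV; exact: ltnW.
  case: ereal_sup Vg VT => [r|//|].
    rewrite lte_fin => rg VT; exists r => // T NT; move: (VT T NT).
    by rewrite lee_fin ler_pdivrMl ?ltr0n ?(leq_ltn_trans _ NT)// mulrC.
  by move=> _ /(_ N.+1 (ltnSn _)); rewrite leNgt ltNyr.
(* Past both [K] and [N], the hypothesis and [c T <= g' * T] force increments of at least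
   [|g'| + 1], a slope exceeding [g'] by at least 1. *)
pose K := (B * (`|g'| + 1) + `|C|) / (g - g').
have K0 : 0 <= K.
  rewrite divr_ge0 ?subr_ge0 ?(ltW g'g)//.
  by rewrite addr_ge0// mulr_ge0 ?(ltW B0)// addr_ge0.
pose M := maxn N.+1 (Num.bound K).
have incr T : (M <= T)%N -> `|g'| + 1 <= c T.+1 - c T.
  rewrite geq_max => /andP[NT KT].
  have : K <= T%:R.
    by rewrite (le_trans (ltW (archi_boundP K0)))// ler_nat.
  rewrite ler_pdivrMr ?subr_gt0// => KT'.
  rewrite -(ler_pM2l B0).
  have := cT T; have := cg' T NT; have := ler_norm C; lra.
have cM k : c M + (`|g'| + 1) * k%:R <= c (M + k)%N.
  elim: k => [|k IH]; first by rewrite mulr0 addr0 addn0.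
  have := incr (M + k)%N (leq_addr _ _); rewrite addnS -natr1; lra.
pose Q : R := `|g' * M%:R - c M|; have Q0 : 0 <= Q by exact: normr_ge0.
have := cM (Num.bound Q); have := cg' (M + Num.bound Q)%N.
have -> : (N < M + Num.bound Q)%N by rewrite (leq_trans _ (leq_addr _ _))// leq_maxl.
move=> /(_ isT); rewrite natrD.
have : Q < (Num.bound Q)%:R by exact: archi_boundP.
have := ler_norm (g' * M%:R - c M); rewrite -/Q.
have := ler_wpM2r (ler0n R (Num.bound Q)) (ler_norm g'); lra.
Qed.

(* Mean over the next state when the active action has probability [q]: [u]
   after a successful transmission, [v] after a failed one, [w] after none. *)
Definition step_mean {R : realType} (rho q u v w : R) : R :=
  q * (rho * u + (1 - rho) * v) + (1 - q) * w.

Lemma le_step_mean (R : realType) (rho q u v w u' v' w' : R) :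
    0 < rho <= 1 -> 0 <= q <= 1 -> u <= u' -> v <= v' -> w <= w' ->
  step_mean rho q u v w <= step_mean rho q u' v' w'.
Proof.
move=> /andP[r0 r1] /andP[q0 q1] uu' vv' ww'.
by rewrite lerD// ler_wpM2l ?subr_ge0// lerD// ler_wpM2l ?subr_ge0// ltW.
Qed.

(** * Optimality inequalities and average cost *)

Section policy_cost.
Context {R : realType} (rho : R) (x : nat -> R) (W : R) (phi : policy R).

Lemma expectation_fromS T h j f :
  expectation_from rho phi T.+1 h j f =
  step_mean rho (active_prob phi h j)
    (expectation_from rho phi T (rcons h (j, true)) 0 f)
    (expectation_from rho phi T (rcons h (j, true)) j.+1 f)
    (expectation_from rho phi T (rcons h (j, false)) j.+1 f).
Proof.
have sumE a (F : nat -> R) : \sum_(k < j.+2) trans rho j a k * F k =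
    trans rho j a 0 * F 0%N + trans rho j a j.+1 * F j.+1.
  rewrite big_ord_recl big_ord_recr /= /bump add1n; congr (_ + _).
  rewrite big1 ?add0r// => i _; rewrite /trans add1n eqSS /=.
  by rewrite (ltn_eqF (ltn_ord i)) !mulr0 addr0 if_same mul0r.
transitivity (\sum_(a : bool) action_prob phi h j a * \sum_(k < j.+2)
    trans rho j a k * expectation_from rho phi T (rcons h (j, a)) k f) => //.
rewrite big_bool !(sumE _ (fun k => expectation_from _ _ _ _ k _)).
rewrite /step_mean /trans /= !eqxx /=; ring.
Qed.

Lemma total_cost_rcons h j a :
  total_cost x W (rcons h (j, a)) = total_cost x W h + (x j + W * a%:R).
Proof. by rewrite /total_cost -cats1 big_cat big_seq1. Qed.

Local Notation cost T h j := (expectation_from rho phi T h j (total_cost x W)).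
Local Notation q h j := (active_prob phi h j).

(** The inequality telescopes over the horizon, and the lower bound on [v] absorbs the terminal
    value. *)
Lemma average_cost_le (v : nat -> R) (g H : R) (j : nat) : 0 < rho <= 1 ->
    (forall i, - H <= v i) ->
    (forall h i, x i + W * q h i + step_mean rho (q h i) (v 0) (v i.+1) (v i.+1)
                 <= v i + g) ->
  (average_cost rho x W phi j <= g%:E)%E.
Proof.
move=> rho01 Hv vg.
have costP T h i : cost T h i <= total_cost x W h + g * T%:R + v i + H.
  elim: T h i => [|T IH] h i; first by have := Hv i; rewrite /=; lra.
  rewrite expectation_fromS.
  apply: (le_trans (le_step_mean _ _ _ _ _ _ _ _ _ rho01 (active_prob_itv _ _ _)
    (IH _ _) (IH _ _) (IH _ _))).
  have := vg h i; rewrite !total_cost_rcons -natr1 /step_mean /=; lra.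
apply: (average_le _ _ _ (v j + H)) => T.
by have := costP T [::] j; rewrite /total_cost big_nil add0r addrA.
Qed.

(* Since [v] may be unbounded, the mean of [v] at time [T] does not vanish in
   the limit; but [v <= A + B x] bounds it by the mean running cost of time
   [T], which is an increment of the total cost. *)
Lemma average_cost_ge (v : nat -> R) (g A B : R) (j : nat) : 0 < rho <= 1 ->
    0 <= W -> 0 < B -> (forall i, v i <= A + B * x i) ->
    (forall h i, v i + g <=
       x i + W * q h i + step_mean rho (q h i) (v 0) (v i.+1) (v i.+1)) ->
  (g%:E <= average_cost rho x W phi j)%E.
Proof.
move=> rho01 W0 B0 vAB vg.
have costP T h i : total_cost x W h + g * T%:R + v i <=
    (1 - B) * cost T h i + B * cost T.+1 h i + A.
  elim: T h i => [|T IH] h i.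
    rewrite expectation_fromS /= !total_cost_rcons /step_mean /=.
    have /andP[q0 _] := active_prob_itv phi h i.
    have := vAB i; have := mulr_ge0 (ltW B0) (mulr_ge0 W0 q0); lra.
  rewrite expectation_fromS (expectation_fromS T.+1).
  have := le_step_mean _ _ _ _ _ _ _ _ _ rho01 (active_prob_itv phi h i)
    (IH (rcons h (i, true)) 0%N) (IH (rcons h (i, true)) i.+1)
    (IH (rcons h (i, false)) i.+1).
  move: (cost T.+1 _ _) (cost T.+1 _ _) (cost T.+1 _ _) => a b c.
  have := vg h i; rewrite !total_cost_rcons -natr1 /step_mean /=; lra.
apply: (average_ge _ _ _ B (A - v j)) => // T.
have := costP T [::] j; rewrite /total_cost big_nil; lra.
Qed.

End policy_cost.

(* [F j] is [\sum_k (1 - rho) ^+ k * x (j + k)]; only its recursion is used, and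
   both metrics have it in closed form, so that no series is needed. *)
Section whittle_index.
Context {R : realType} (rho : R) (x F : nat -> R) (A B : R).
Hypothesis rho01 : 0 < rho <= 1.
Hypothesis x0 : 0 <= x 0.
Hypothesis xS : forall j, x j <= x j.+1.
Hypothesis FE : forall j, F j = x j + (1 - rho) * F j.+1.
Hypothesis FS : forall j, F j <= F j.+1.
Hypothesis B0 : 0 < B.
Hypothesis FAB : forall j, F j <= A + B * x j.

(** * Gain and bias of a threshold policy *)

Let X n := \sum_(i < n) x i.

Let XS n : X n.+1 = X n + x n. Proof. by rewrite /X big_ord_recr. Qed.

Let x_ge0 j : 0 <= x j.
Proof. by elim: j => // j /le_trans; apply. Qed.

Let X_ge0 n : 0 <= X n. Proof. exact: sumr_ge0. Qed.

Let le_x : {homo x : i j / (i <= j)%N >-> i <= j}.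
Proof. exact: homo_leq lexx le_trans xS. Qed.

Let le_F : {homo F : i j / (i <= j)%N >-> i <= j}.
Proof. exact: homo_leq lexx le_trans FS. Qed.

Let le_X : {homo X : i j / (i <= j)%N >-> i <= j}.
Proof. by apply: (homo_leq lexx le_trans) => i; rewrite XS lerDl. Qed.

Let rho_gt0 : 0 < rho. Proof. by case/andP: rho01. Qed.

Let rho_le1 : rho <= 1. Proof. by case/andP: rho01. Qed.

(** The weights [(1 - rho) ^+ k] have sum [1 / rho], so [rho * F j] is a weighted mean of states
    from [x j] upwards. *)
Let x_le_F j : x j <= rho * F j.
Proof.
have : 0 <= 1 - rho by rewrite subr_ge0.
move=> /ler_wpM2l /(_ _ _ (FS j)); have := FE j; lra.
Qed.

Let F_ge0 j : 0 <= F j.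
Proof. by rewrite -(pmulr_rge0 _ rho_gt0) (le_trans _ (x_le_F j)). Qed.

(* A renewal cycle of the threshold policy [n] lasts [n + 1 / rho] slots. *)
Let gain n W := (X n + F n + W / rho) / (n%:R + rho^-1).

Let cycle_gt0 n : 0 < n%:R + rho^-1.
Proof. by rewrite ltr_wpDl ?invr_gt0. Qed.

Let gainE n W : gain n W * (n%:R + rho^-1) = X n + F n + W / rho.
Proof. by rewrite /gain divfK// gt_eqF. Qed.

Let gain_ge0 n W : 0 <= W -> 0 <= gain n W.
Proof.
move=> W0; rewrite divr_ge0 ?(ltW (cycle_gt0 _))// !addr_ge0//.
by rewrite divr_ge0// ltW.
Qed.

(** Relative value function, normalised to vanish at [x 0]. From the threshold on, it is the
    expected cost until the next success minus the gain over the mean waiting time [1 / rho]. The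
    two branches agree at [j = n] by [gainE]. *)
Let bias n W j :=
  if (j <= n)%N then gain n W * j%:R - X j else F j + (W - gain n W) / rho.

Let bias_active n W j : (n <= j)%N -> bias n W j = F j + (W - gain n W) / rho.
Proof.
rewrite /bias leq_eqVlt => /predU1P[<-|nj]; last by rewrite leqNgt nj.
rewrite leqnn; have := gainE n W; rewrite mulrDr; lra.
Qed.

Let bias0 n W : bias n W 0 = 0.
Proof. by rewrite /bias /= mulr0 /X big_ord0 subr0. Qed.

Let bias_passiveE n W j : (j < n)%N ->
  bias n W j + gain n W = x j + bias n W j.+1.
Proof. by move=> jn; rewrite /bias jn (ltnW jn) XS -natr1; lra. Qed.

Let bias_activeE n W j : (n <= j)%N ->
  bias n W j + gain n W = x j + W + (1 - rho) * bias n W j.+1.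
Proof.
move=> nj; rewrite !bias_active ?(leqW nj)// (FE j).
by field; rewrite gt_eqF.
Qed.

(** Being an equality, it feeds both the upper and the lower criterion, so [gain n W] is the exact
    average cost from every initial state. *)
Let poisson n W j (q := (n <= j)%N%:R) : bias n W j + gain n W =
  x j + W * q + step_mean rho q (bias n W 0) (bias n W j.+1) (bias n W j.+1).
Proof.
rewrite /q /step_mean bias0; case: (leqP n j) => nj /=.
  rewrite (bias_activeE _ _ _ nj); lra.
rewrite (bias_passiveE _ _ _ nj); lra.
Qed.

Let bias_ge n W j : 0 <= W -> - (X n + gain n W / rho) <= bias n W j.
Proof.
move=> W0; have g0 := gain_ge0 n W W0.
have gr0 : 0 <= gain n W / rho by rewrite divr_ge0// ltW.
rewrite /bias; case: leqP => [jn|nj].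
  have := le_X _ _ jn; have := mulr_ge0 g0 (ler0n R j); lra.
have := F_ge0 j; have := X_ge0 n; have : 0 <= W / rho by rewrite divr_ge0// ltW.
lra.
Qed.

Let bias_le n W j : 0 <= W ->
  bias n W j <= gain n W * n%:R + `|A| + W / rho + B * x j.
Proof.
move=> W0; have g0 := gain_ge0 n W W0.
have gr0 : 0 <= gain n W / rho by rewrite divr_ge0// ltW.
have Wr0 : 0 <= W / rho by rewrite divr_ge0// ltW.
have := mulr_ge0 (ltW B0) (x_ge0 j); rewrite /bias; case: leqP => [jn|nj].
  have : gain n W * j%:R <= gain n W * n%:R by rewrite ler_wpM2l// ler_nat.
  have := X_ge0 j; have := normr_ge0 A; lra.
have := FAB j; have := ler_norm A; have := mulr_ge0 g0 (ler0n R n); lra.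
Qed.

Let average_threshold_le n W j : 0 <= W ->
  (average_cost rho x W (threshold R n) j <= (gain n W)%:E)%E.
Proof.
move=> W0; apply: (average_cost_le _ _ _ _ (bias n W)) => // [i|h i].
  exact: bias_ge.
by rewrite poisson.
Qed.

Let average_threshold_ge n W j : 0 <= W ->
  ((gain n W)%:E <= average_cost rho x W (threshold R n) j)%E.
Proof.
move=> W0; apply: (average_cost_ge _ _ _ _ (bias n W) _ _ _ _ rho01 W0 B0
  (fun i => bias_le n W i W0)) => h i.
by rewrite poisson.
Qed.

(* The solution in [W] of [gain n W = gain n.+1 W]. *)
Definition switching_cost n := rho * (rho * n.+1%:R * F n.+1 - X n.+1).

(** * Switching costs and optimal thresholds *)

Let gain_lt n W : W < switching_cost n -> gain n W < gain n.+1 W.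
Proof.
move=> Wn; rewrite /gain ltr_pdivrMr// mulrAC ltr_pdivlMr//.
rewrite -subr_gt0 (_ : _ - _ = (switching_cost n - W) / rho).
  by rewrite divr_gt0// subr_gt0.
rewrite /switching_cost XS (FE n) -natr1; field; exact: lt0r_neq0.
Qed.

Let gain_switching n : gain n.+1 (switching_cost n) = rho * F n.+1.
Proof.
apply: (mulIf (lt0r_neq0 (cycle_gt0 n.+1))).
by rewrite gainE /switching_cost; field; exact: lt0r_neq0.
Qed.

(** The increment is at least [rho * (rho * F n.+2 - x n.+1)], and [rho * F n.+2] dominates
    [x n.+2]. *)
Let switching_costS n : switching_cost n <= switching_cost n.+1.
Proof.
rewrite ler_pM2l// (XS n.+1) -(natr1 n.+1).
have := x_le_F n.+2; have := xS n.+1.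
have : rho * n.+1%:R * F n.+1 <= rho * n.+1%:R * F n.+2.
  by rewrite ler_wpM2l// mulr_ge0// ltW.
lra.
Qed.

Let switching_cost_ge0 n : 0 <= switching_cost n.
Proof.
elim: n => [|n /le_trans]; last exact.
rewrite mulr_ge0 ?(ltW rho_gt0)// /X big_ord1 mulr1 subr_ge0.
exact: le_trans (xS 0) (x_le_F 1).
Qed.

Let le_switching_cost :
  {homo switching_cost : i j / (i <= j)%N >-> i <= j}.
Proof. exact: homo_leq lexx le_trans switching_costS. Qed.

(** Here [rho * bias n.+1 W n.+1 = W]: in [x n] the activation cost balances the expected saving.
    Monotonicity of [F] makes passivity no better above, and monotonicity of the bias makes activity
    no better below. *)
Let optimal_switching n :
  optimal rho x (switching_cost n) (threshold R n.+1).
Proof.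
set W := switching_cost n => j psi; have W0 : 0 <= W by exact: switching_cost_ge0.
apply: (le_trans (average_threshold_le _ _ _ W0)).
apply: (average_cost_ge _ _ _ _ (bias n.+1 W) _ _ _ _ rho01 W0 B0
  (fun i => bias_le n.+1 W i W0)) => h i.
have gE : gain n.+1 W = rho * F n.+1 by exact: gain_switching.
have passive : bias n.+1 W i + gain n.+1 W <= x i + bias n.+1 W i.+1.
  case: (ltnP i n.+1) => ni; first by rewrite bias_passiveE.
  rewrite !bias_active ?(leqW ni)// gE (FE i).
  have : rho * F n.+1 <= rho * F i.+1 by rewrite ler_pM2l// le_F// leqW.
  lra.
have active : bias n.+1 W i + gain n.+1 W <=
    x i + W + (1 - rho) * bias n.+1 W i.+1.
  case: (leqP n.+1 i) => ni; first by rewrite bias_activeE.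
  rewrite bias_passiveE//.
  (* Descending from the threshold, each increment of the bias is [rho * F n.+1 - x k], nonnegative
     for [k <= n]. *)
  have le_bias m : bias n.+1 W (n.+1 - m) <= bias n.+1 W n.+1.
    elim: m => [|m IH]; first by rewrite subn0.
    case: (leqP n.+1 m) => mn.
      (* Truncated subtraction: both ranks are 0. *)
      by move: IH; rewrite (eqP mn) (eqP (leqW mn)).
    apply: le_trans IH; rewrite -[X in _ <= bias _ _ X](subnSK mn).
    have kn : (n.+1 - m.+1 < n.+1)%N by rewrite subSS ltnS leq_subr.
    have := bias_passiveE _ W _ kn; rewrite gE.
    have := x_le_F n.+1; have := le_x _ _ (ltnW kn); lra.
  have := le_bias (n.+1 - i.+1)%N; rewrite subKn//.
  rewrite (bias_active _ _ _ (leqnn n.+1)) -(ler_pM2l rho_gt0) mulrDr.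
  rewrite (mulrC _ (_ / rho)) divfK ?gt_eqF// gE; lra.
(* A randomized action averages the two inequalities. *)
rewrite /step_mean.
have /andP[q0 q1] := active_prob_itv psi h i; rewrite bias0.
have q1' : 0 <= 1 - active_prob psi h i by rewrite subr_ge0.
have := ler_wpM2l q0 active; have := ler_wpM2l q1' passive; lra.
Qed.

Lemma whittle_index_switching n : is_whittle_index rho x n (switching_cost n).
Proof.
split=> [|W [W0 [m [mopt nm]]]].
  by split=> //; exists n.+1; split.
rewrite leNgt; apply/negP => Wn.
(* The competitor is the preceding threshold, still at least [n]. *)
case: m nm mopt => // m nm /(_ 0%N (threshold R m)).
apply/negP; rewrite -ltNge.
apply: (le_lt_trans (average_threshold_le m W 0 W0)).
apply: lt_le_trans (average_threshold_ge m.+1 W 0 W0).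
by rewrite lte_fin gain_lt// (lt_le_trans Wn)// le_switching_cost.
Qed.

End whittle_index.

(** * Closed forms for the two metrics *)

Lemma whittle_index_aoi (R : realType) (rho : R) n : 0 < rho <= 1 ->
  is_whittle_index rho (@aoi R) n (n%:R * (n%:R + 1) * rho / 2 + n%:R + 1).
Proof.
move=> rho01; have /andP[rho0 rho1] := rho01; have rhoN0 := lt0r_neq0 rho0.
(* With [q = 1 - rho], the sums of [q ^+ k] and [k * q ^+ k] are [1 / rho] and [q / rho ^+ 2]. *)
pose F j : R := j%:R / rho + (1 - rho) / rho ^+ 2.
have sumE k : \sum_(i < k) aoi R i = k%:R * (k%:R - 1) / 2.
  elim: k => [|k IH]; first by rewrite big_ord0 !mul0r.
  by rewrite big_ord_recr /= IH /aoi -natr1; field.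
have -> : n%:R * (n%:R + 1) * rho / 2 + n%:R + 1 =
    switching_cost rho (@aoi R) F n.
  by rewrite /switching_cost sumE /F -natr1; field.
apply: (whittle_index_switching _ _ _ ((1 - rho) / rho ^+ 2) rho^-1) => //.
- by move=> j; rewrite ler_nat.
- by move=> j; rewrite /F /aoi -natr1; field.
- by move=> j; rewrite /F lerD2r ler_pM2r ?invr_gt0// ler_nat.
- by rewrite invr_gt0.
- by move=> j; rewrite /F /aoi addrC [X in _ + X]mulrC.
Qed.

Lemma whittle_index_aoii (R : realType) (d p rho : R) n :
    0 < d * p -> 0 < rho <= 1 ->
  is_whittle_index rho (aoii d p) n
    (d * p * (1 / 3 * rho * n%:R ^+ 3 + (1 + rho / 2) * n%:R ^+ 2
              + (1 + rho / 6 + 1 / rho) * n%:R + 1 / rho)).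
Proof.
move=> dp0 rho01; have /andP[rho0 rho1] := rho01; have rhoN0 := lt0r_neq0 rho0.
(* Split [(j + k) * (j + k + 1) / 2] as [j * (j + 1) / 2 + j * k + k * (k + 1) / 2]; the last term
   sums to [(1 - rho) / rho ^+ 3]. *)
pose F (j : nat) : R := d * p * (j%:R * (j%:R + 1) / 2 / rho
  + j%:R * ((1 - rho) / rho ^+ 2) + (1 - rho) / rho ^+ 3).
have q2 : 0 <= (1 - rho) / rho ^+ 2 by rewrite divr_ge0 ?exprn_ge0 ?subr_ge0// ltW.
have q3 : 0 <= (1 - rho) / rho ^+ 3 by rewrite divr_ge0 ?exprn_ge0 ?subr_ge0// ltW.
have sqr j : j%:R * (j%:R + 1) / 2 <= j.+1%:R * (j.+1%:R + 1) / 2 :> R.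
  by have := ler0n R j; rewrite -(natr1 j); lra.
have sumE k : \sum_(i < k) aoii d p i =
    d * p * (k%:R * (k%:R - 1) * (k%:R + 1) / 6).
  elim: k => [|k IH]; first by rewrite big_ord0 !mul0r mulr0.
  by rewrite big_ord_recr /= IH /aoii -natr1; field.
have -> : d * p * (1 / 3 * rho * n%:R ^+ 3 + (1 + rho / 2) * n%:R ^+ 2
      + (1 + rho / 6 + 1 / rho) * n%:R + 1 / rho) =
    switching_cost rho (aoii d p) F n.
  by rewrite /switching_cost sumE /F -natr1; field.
(* The factor 2 comes from bounding the linear term of [F] by [j <= 2 * (j * (j + 1) / 2)]. *)
apply: (whittle_index_switching _ _ _ (d * p * ((1 - rho) / rho ^+ 3))
  (rho^-1 + 2 * ((1 - rho) / rho ^+ 2))) => //.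
- by rewrite /aoii !mul0r mulr0.
- by move=> j; rewrite /aoii ler_pM2l.
- by move=> j; rewrite /F /aoii -natr1; field.
- move=> j; rewrite /F ler_pM2l// lerD2r lerD//.
    by rewrite ler_pM2r ?invr_gt0.
  by rewrite ler_wpM2r// ler_nat.
- by rewrite ltr_pwDl ?invr_gt0// mulr_ge0.
- move=> j; rewrite /F /aoii.
  have : j%:R <= j%:R * (j%:R + 1) :> R.
    by rewrite mulrDr mulr1 lerDr mulr_ge0.
  move=> /(ler_wpM2r q2) /(ler_wpM2l (ltW dp0)); lra.
Qed.

Theorem theorem2 (R : realType) (d p rho : R)
    (hd : 0 < d) (hp : 0 < p <= 1) (hrho : 0 < rho <= 1) (n : nat) :
  is_whittle_index rho (@aoi R) n
    (n%:R * (n%:R + 1) * rho / 2 + n%:R + 1)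
  /\
  is_whittle_index rho (aoii d p) n
    (d * p * (1 / 3 * rho * n%:R ^+ 3 + (1 + rho / 2) * n%:R ^+ 2
              + (1 + rho / 6 + 1 / rho) * n%:R + 1 / rho)).
Proof.
case/andP: hp => p0 _.
by split; [exact: whittle_index_aoi | apply: whittle_index_aoii; rewrite ?mulr_gt0].
Qed.
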